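(* The ribbon category $\mathfrak E$ (with simple objects $\mathbf 1$ and $\mathbf A$, and the tensor product, associativity, braiding, twist and duality given in the context) is modular.
   Context: Category $\mathfrak E$. Let $I=\{\mathbf 1,\mathbf A\}$. Objects are finite ordered tuples $(x_1,\dots,x_n)$, $x_i\in I$, written as noncommutative sums $x_1+\dots+x_n$. A morphism $f:\sum_i x_i\to\sum_j y_j$ is a family $a_i^j\in\mathbb C$ with $a_i^j=0$ if $x_i\ne y_j$; equivalently a pair of matrices $[f]_{\mathbf 1},[f]_{\mathbf A}$ (columns: summands of the source equal to the given symbol, rows: those of the target, in order). Composition is written left to right (first $f$, then $g$): $[f\circ g]_S=[g]_S[f]_S$, $S\in I$; identities have identity matrices. Tensor product. $\mathbf 1\otimes\mathbf 1=\mathbf 1$, $\mathbf 1\otimes\mathbf A=\mathbf A\otimes\mathbf 1=\mathbf A$, $\mathbf A\otimes\mathbf A=\mathbf 1+\mathbf A$, and $(\sum_i x_i)\otimes(\sum_j y_j)=\sum_i\sum_j x_i\otimes y_j$ in lexicographic order. For $f=(f_i^j)$, $g=(g_r^s)$ the entry of $f\otimes g$ from a summand of $x_i\otimes z_r$ to a summand of $y_j\otimes t_s$ is $f_i^jg_r^s$ if $x_i=y_j$, $z_r=t_s$ and the two summands are the same summand of $x_i\otimes z_r=y_j\otimes t_s$, and $0$ otherwise. The unit object is $\mathbf 1$ and the unit isomorphisms are identities. Constants: $\varepsilon$ is a root of $\varepsilon^2=\varepsilon+1$, $\sqrt\varepsilon$ a fixed square root, $x,y\in\mathbb C$ nonzero,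 $\beta_\varepsilon\in\{e^{3\pi i/5},e^{-3\pi i/5}\}$ if $\varepsilon>0$ and $\beta_\varepsilon\in\{e^{\pi i/5},e^{-\pi i/5}\}$ if $\varepsilon<0$. Associativity $\alpha_{X,Y,Z}:(X\otimes Y)\otimes Z\to X\otimes(Y\otimes Z)$: identity for $X,Y,Z\in I$ not all equal to $\mathbf A$; $[\alpha_{\mathbf A,\mathbf A,\mathbf A}]_{\mathbf 1}=(1)$, $[\alpha_{\mathbf A,\mathbf A,\mathbf A}]_{\mathbf A}=\begin{pmatrix}\frac1\varepsilon&\frac x{\sqrt\varepsilon}\\\frac1{x\sqrt\varepsilon}&-\frac1\varepsilon\end{pmatrix}$; extended by linearity (the summands from $(x_i\otimes y_j)\otimes z_k$ are mapped to those from $x_i\otimes(y_j\otimes z_k)$ by $\alpha_{x_i,y_j,z_k}$). Braiding $c_{X,Y}:X\otimes Y\to Y\otimes X$: for $X,Y\in I$ identity if one of them is $\mathbf 1$, $[c_{\mathbf A,\mathbf A}]_{\mathbf 1}=(\beta_\varepsilon^2)$, $[c_{\mathbf A,\mathbf A}]_{\mathbf A}=(\beta_\varepsilon)$; extended by linearity ($x_i\otimes y_j\to y_j\otimes x_i$ by $c_{x_i,y_j}$). Twist $\theta_X:X\to X$: $\theta_{\mathbf 1}=id$, $\theta_{\mathbf A}=\beta_\varepsilon^{-2}id_{\mathbf A}$, extended diagonally. Duality: $X^*=X$; $b_X:\mathbf 1\to X\otimes X$ and $d_X:X\otimes X\to\mathbf 1$ have nonzero entries only at the summand $\mathbf 1$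 of $x_i\otimes x_i$, $i=1,\dots,n$, namely $y$ (for $b_X$) and $1/y$ (for $d_X$) if $x_i=\mathbf 1$, and $y\sqrt\varepsilon$ and $\sqrt\varepsilon/y$ if $x_i=\mathbf A$. Modular (Turaev's sense, ground ring $\mathbb C$): a ribbon category whose Hom-sets are abelian groups with bilinear composition and tensor product, with a finite family of simple objects (here $\mathbf 1,\mathbf A$) containing the unit object and closed under duality up to isomorphism, dominating every object (each identity morphism is a finite sum of morphisms factoring through simple objects of the family), and such that the matrix $S=(S_{X,Y})_{X,Y\in I}$ is invertible over $\mathbb C$, where $S_{X,Y}$ is the quantum trace of $c_{X,Y}\circ c_{Y,X}$. *)

(* Defs.v *)
From HB Require Import structures.
From mathcomp Require Import all_boot all_order all_algebra.
From mathcomp Require Import reals trigo.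
From mathcomp Require Import complex.

Set Implicit Arguments.
Unset Strict Implicit.
Unset Printing Implicit Defensive.

Import Order.TTheory GRing.Theory Num.Theory.
Local Open Scope ring_scope.

Declare Scope cat_scope.
Delimit Scope cat_scope with cat.

Reserved Notation "f ;; g" (at level 45, left associativity).
Reserved Notation "X \ot Y" (at level 40, left associativity).
Reserved Notation "f \otm g" (at level 40, left associativity).

(* The data of a (not necessarily strict) monoidal Ab-category with braiding,  *)
(* twist and duality; the laws are in [is_ribbon] and [is_Ab_bilinear].        *)
(* Composition is written from left to right throughout.                       *)
Record ribbon_data := RibbonData {
  obj :> Type;
  mor : obj -> obj -> zmodType;
  idm : forall X, mor X X;
  compm : forall X Y Z, mor X Y -> mor Y Z -> mor X Z;
  tunit : obj;
  tens : obj -> obj -> obj;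
  tensm : forall X Y Z T,
    mor X Y -> mor Z T -> mor (tens X Z) (tens Y T);
  assoc : forall X Y Z, mor (tens (tens X Y) Z) (tens X (tens Y Z));
  lunit : forall X, mor (tens tunit X) X;
  runit : forall X, mor (tens X tunit) X;
  braid : forall X Y, mor (tens X Y) (tens Y X);
  twist : forall X, mor X X;
  dual : obj -> obj;
  coev : forall X, mor tunit (tens X (dual X));
  ev : forall X, mor (tens (dual X) X) tunit }.

Arguments tunit {_}.
Arguments idm {_} X.
Arguments assoc {_} X Y Z.
Arguments lunit {_} X.
Arguments runit {_} X.
Arguments braid {_} X Y.
Arguments twist {_} X.
Arguments coev {_} X.
Arguments ev {_} X.

Notation "f ;; g" := (compm f g) : cat_scope.
Notation "X \ot Y" := (tens X Y) : cat_scope.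
Notation "f \otm g" := (tensm f g) : cat_scope.
Local Open Scope cat_scope.

Definition inverse_mors (E : ribbon_data) (X Y : E)
    (f : mor X Y) (g : mor Y X) : Prop :=
  f ;; g = idm X /\ g ;; f = idm Y.

Definition is_iso (E : ribbon_data) (X Y : E) (f : mor X Y) : Prop :=
  exists g : mor Y X, inverse_mors f g.

Definition isomorphic (E : ribbon_data) (X Y : E) : Prop :=
  exists f : mor X Y, is_iso f.

Record is_category (E : ribbon_data) : Prop := IsCategory {
  compmA : forall (X Y Z T : E) (f : mor X Y) (g : mor Y Z) (h : mor Z T),
    (f ;; g) ;; h = f ;; (g ;; h);
  compm_idl : forall (X Y : E) (f : mor X Y), idm X ;; f = f;
  compm_idr : forall (X Y : E) (f : mor X Y), f ;; idm Y = f }.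

Record is_Ab_bilinear (E : ribbon_data) : Prop := IsAbBilinear {
  compmDl : forall (X Y Z : E) (f f' : mor X Y) (g : mor Y Z),
    (f + f') ;; g = f ;; g + f' ;; g;
  compmDr : forall (X Y Z : E) (f : mor X Y) (g g' : mor Y Z),
    f ;; (g + g') = f ;; g + f ;; g';
  tensmDl : forall (X Y Z T : E) (f f' : mor X Y) (g : mor Z T),
    (f + f') \otm g = f \otm g + f' \otm g;
  tensmDr : forall (X Y Z T : E) (f : mor X Y) (g g' : mor Z T),
    f \otm (g + g') = f \otm g + f \otm g' }.

Record is_monoidal (E : ribbon_data) : Prop := IsMonoidal {
  tensm_id : forall X Y : E, idm X \otm idm Y = idm (X \ot Y);
  tensm_compm : forall (X Y Z X' Y' Z' : E) (f : mor X Y) (g : mor Y Z)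
      (f' : mor X' Y') (g' : mor Y' Z'),
    (f ;; g) \otm (f' ;; g') = (f \otm f') ;; (g \otm g');
  assoc_iso : forall X Y Z : E, is_iso (assoc X Y Z);
  assoc_nat : forall (X Y Z X' Y' Z' : E)
      (f : mor X X') (g : mor Y Y') (h : mor Z Z'),
    ((f \otm g) \otm h) ;; assoc X' Y' Z'
      = assoc X Y Z ;; (f \otm (g \otm h));
  lunit_iso : forall X : E, is_iso (lunit X);
  lunit_nat : forall (X Y : E) (f : mor X Y),
    (idm tunit \otm f) ;; lunit Y = lunit X ;; f;
  runit_iso : forall X : E, is_iso (runit X);
  runit_nat : forall (X Y : E) (f : mor X Y),
    (f \otm idm tunit) ;; runit Y = runit X ;; f;
  pentagon : forall X Y Z T : E,
    assoc (X \ot Y) Z T ;; assoc X Y (Z \ot T)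
      = (assoc X Y Z \otm idm T) ;; assoc X (Y \ot Z) T
          ;; (idm X \otm assoc Y Z T);
  triangle : forall X Y : E,
    assoc X tunit Y ;; (idm X \otm lunit Y) = runit X \otm idm Y }.

Record is_braided (E : ribbon_data) : Prop := IsBraided {
  braid_iso : forall X Y : E, is_iso (braid X Y);
  braid_nat : forall (X Y X' Y' : E) (f : mor X X') (g : mor Y Y'),
    (f \otm g) ;; braid X' Y' = braid X Y ;; (g \otm f);
  hexagon1 : forall X Y Z : E,
    assoc X Y Z ;; braid X (Y \ot Z) ;; assoc Y Z X
      = (braid X Y \otm idm Z) ;; assoc Y X Z ;; (idm Y \otm braid X Z);
  (* [a] is the inverse of the associativity isomorphism. *)
  hexagon2 : forall (X Y Z : E) (a : mor (X \ot (Z \ot Y)) ((X \ot Z) \ot Y)),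
    inverse_mors (assoc X Z Y) a ->
    braid (X \ot Y) Z
      = assoc X Y Z ;; (idm X \otm braid Y Z) ;; a
          ;; (braid X Z \otm idm Y) ;; assoc Z X Y }.

Record is_twisted (E : ribbon_data) : Prop := IsTwisted {
  twist_iso : forall X : E, is_iso (twist X);
  twist_nat : forall (X Y : E) (f : mor X Y), f ;; twist Y = twist X ;; f;
  twist_tens : forall X Y : E,
    twist (X \ot Y) = (twist X \otm twist Y) ;; braid X Y ;; braid Y X }.

Record is_dual_compatible (E : ribbon_data) : Prop := IsDualCompatible {
  zigzag1 : forall X : E,
    (coev X \otm idm X) ;; assoc X (dual X) X ;; (idm X \otm ev X) ;; runit X
      = lunit X;
  (* [a] is the inverse of the associativity isomorphism. *)
  zigzag2 : forall (X : E)
      (a : mor (dual X \ot (X \ot dual X)) ((dual X \ot X) \ot dual X)),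
    inverse_mors (assoc (dual X) X (dual X)) a ->
    (idm (dual X) \otm coev X) ;; a ;; (ev X \otm idm (dual X))
        ;; lunit (dual X)
      = runit (dual X);
  coev_twist : forall X : E,
    coev X ;; (twist X \otm idm (dual X))
      = coev X ;; (idm X \otm twist (dual X)) }.

Record is_ribbon (E : ribbon_data) : Prop := IsRibbon {
  ribbon_category : is_category E;
  ribbon_monoidal : is_monoidal E;
  ribbon_braided : is_braided E;
  ribbon_twisted : is_twisted E;
  ribbon_dual : is_dual_compatible E }.

Definition qtrace (E : ribbon_data) (X : E) (f : mor X X)
    : mor (tunit : E) tunit :=
  coev X ;; ((f ;; twist X) \otm idm (dual X)) ;; braid X (dual X) ;; ev X.

(* The ring [End tunit] is identified with [K] through [ground]. *)
Record is_ground_ring (K : comUnitRingType) (E : ribbon_data)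
    (ground : K -> mor (tunit : E) tunit) : Prop := IsGroundRing {
  ground_bij : bijective ground;
  ground_add : forall k l : K, ground (k + l) = ground k + ground l;
  ground_one : ground 1 = idm tunit;
  ground_mul : forall k l : K, ground (k * l) = ground k ;; ground l }.

(* [X] is simple when [k |-> k \otm idm X] is a bijection from [End tunit] onto *)
(* [End X], [tunit \ot X] being identified with [X] through [lunit X].          *)
Definition is_simple (E : ribbon_data) (X : E) : Prop :=
  forall f : mor X X, exists! k : mor (tunit : E) tunit,
    (k \otm idm X) ;; lunit X = lunit X ;; f.

Definition is_dominated (E : ribbon_data) (I : finType) (V : I -> E) (X : E)
    : Prop :=
  exists (n : nat) (i : 'I_n -> I)
         (f : forall r, mor X (V (i r))) (g : forall r, mor (V (i r)) X),
    idm X = \sum_(r < n) (f r ;; g r).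

Record is_modular (K : comUnitRingType) (E : ribbon_data)
    (ground : K -> mor (tunit : E) tunit) (I : finType) (V : I -> E) : Prop :=
  IsModular {
  modular_ribbon : is_ribbon E;
  modular_Ab : is_Ab_bilinear E;
  modular_ground : is_ground_ring ground;
  modular_simple : forall i, is_simple (V i);
  modular_one : exists i, V i = tunit;
  modular_dual : forall i, exists j, isomorphic (V j) (dual (V i));
  modular_dominated : forall X : E, is_dominated V X;
  modular_nondegenerate : exists2 S : I -> I -> K,
    forall i j,
      ground (S i j) = qtrace (braid (V i) (V j) ;; braid (V j) (V i)) &
    \matrix_(p < #|I|, q < #|I|) S (enum_val p) (enum_val q) \in unitmx }.

Inductive sym := S1 | SA.

Definition bool_of_sym (x : sym) : bool := if x is SA then true else false.
Definition sym_of_bool (b : bool) : sym := if b then SA else S1.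
Lemma bool_of_symK : cancel bool_of_sym sym_of_bool. Proof. by case. Qed.
HB.instance Definition _ := Finite.copy sym (can_type bool_of_symK).

Definition summand (X : seq sym) (i : 'I_(size X)) : sym :=
  tnth (in_tuple X) i.
Arguments summand : clear implicits.

Section Morphisms.
Variable C : fieldType.

(* The entry [f i j] is $a_i^j$: rows are indexed by the source and columns    *)
(* by the target, so that composition from left to right is the product of     *)
(* matrices in the same order.                                                 *)
Definition supported (X Y : seq sym) : {pred 'M[C]_(size X, size Y)} :=
  fun f => [forall i, forall j, (summand X i != summand Y j) ==> (f i j == 0)].
Arguments supported : clear implicits.

Lemma supportedP (X Y : seq sym) (f : 'M[C]_(size X, size Y)) :
  reflect (forall i j, summand X i != summand Y j -> f i j = 0)
    (f \in supported X Y).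
Proof.
apply: (iffP forallP) => [H i j ne | H i].
  by have /forallP/(_ j)/implyP/(_ ne)/eqP := H i.
by apply/forallP => j; apply/implyP => ne; apply/eqP/H.
Qed.

Fact supported_zmod_closed X Y : zmod_closed (supported X Y).
Proof.
split=> [|f g /supportedP Hf /supportedP Hg]; apply/supportedP => i j ne.
  by rewrite mxE.
by rewrite !mxE Hf // Hg // subr0.
Qed.
HB.instance Definition _ X Y :=
  GRing.isZmodClosed.Build _ (supported X Y) (supported_zmod_closed X Y).

Record ehom (X Y : seq sym) := EHom {
  ehom_mx :> 'M[C]_(size X, size Y);
  ehom_supported : ehom_mx \in supported X Y }.
HB.instance Definition _ X Y := [isSub for @ehom_mx X Y].
HB.instance Definition _ X Y := [Choice of ehom X Y by <:].
HB.instance Definition _ X Y := [SubChoice_isSubZmodule of ehom X Y by <:].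

Definition restrict_mx X Y (F : 'I_(size X) -> 'I_(size Y) -> C) :=
  \matrix_(i, j) (if summand X i == summand Y j then F i j else 0).

Fact restrict_mx_supported X Y F : @restrict_mx X Y F \in supported X Y.
Proof. by apply/supportedP => i j /negbTE ne; rewrite mxE ne. Qed.

Definition mkhom X Y (F : 'I_(size X) -> 'I_(size Y) -> C) : ehom X Y :=
  EHom (restrict_mx_supported F).

Definition eid X : ehom X X := mkhom (fun i j => (i == j)%:R).

Fact mulmx_supported X Y Z (f : ehom X Y) (g : ehom Y Z) :
  ehom_mx f *m ehom_mx g \in supported X Z.
Proof.
apply/supportedP => i k ne; rewrite mxE big1 // => j _.
have [e|ne'] := eqVneq (summand X i) (summand Y j); last first.
  by have /supportedP -> := ehom_supported f; rewrite ?mul0r.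
by have /supportedP -> := ehom_supported g; rewrite ?mulr0 -?e.
Qed.

Definition ecomp X Y Z (f : ehom X Y) (g : ehom Y Z) : ehom X Z :=
  EHom (mulmx_supported f g).

Definition stens (x y : sym) : seq sym :=
  match x, y with
  | S1, z | z, S1 => [:: z]
  | SA, SA => [:: S1; SA]
  end.

Definition etens (X Y : seq sym) : seq sym :=
  flatten [seq flatten [seq stens x y | y <- Y] | x <- X].

(* The summands of $X\otimes Y$ in order: the label $(i, j, z)$ stands for the *)
(* summand $z$ of $x_i\otimes y_j$; no symbol occurs twice in $x_i\otimes y_j$.*)
Definition labels (X Y : seq sym) : seq ('I_(size X) * 'I_(size Y) * sym) :=
  flatten [seq
    flatten [seq [seq (i, j, z) | z <- stens (summand X i) (summand Y j)]
            | j <- enum 'I_(size Y)]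
    | i <- enum 'I_(size X)].

Lemma labels_etens X Y : [seq l.2 | l <- labels X Y] = etens X Y.
Proof.
have tabE (T : Type) (F : sym -> T) (Z : seq sym) :
    [seq F z | z <- Z] = [seq F (summand Z i) | i <- enum 'I_(size Z)].
  by rewrite -[in LHS](in_tupleE Z) -[tval _ in LHS]map_tnth_enum -map_comp.
rewrite /labels /etens map_flatten -map_comp tabE; congr flatten.
apply: eq_map => i /=; rewrite map_flatten -map_comp tabE; congr flatten.
by apply: eq_map => j /=; rewrite -map_comp map_id.
Qed.

Lemma size_etens X Y : size (etens X Y) = size (labels X Y).
Proof. by rewrite -labels_etens size_map. Qed.

Definition label X Y (p : 'I_(size (etens X Y)))
    : 'I_(size X) * 'I_(size Y) * sym :=
  tnth (in_tuple (labels X Y)) (cast_ord (size_etens X Y) p).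

Definition etensm X Y Z T (f : ehom X Y) (g : ehom Z T)
    : ehom (etens X Z) (etens Y T) :=
  mkhom (fun p q =>
    let: (i, r, z) := label p in let: (j, s, t) := label q in
    if [&& summand X i == summand Y j, summand Z r == summand T s & z == t]
    then ehom_mx f i j * ehom_mx g r s else 0).

Lemma etens1s X : etens [:: S1] X = X.
Proof. by rewrite /etens /= cats0; elim: X => //= x X ->. Qed.

Lemma etenss1 X : etens X [:: S1] = X.
Proof. by rewrite /etens; elim: X => //= -[] X ->. Qed.

Definition eid_cast X Y (e : X = Y) : ehom X Y := ecast Z (ehom X Z) e (eid X).

Section Constants.
Variables eps sqrt_eps x y beta : C.

(* Entry of $\alpha_{a,b,c}$, for symbols $a, b, c$, from the summand $w$ of   *)
(* $u\otimes c$, where $u$ is a summand of $a\otimes b$, to the summand $w$ of *)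
(* $a\otimes v$, where $v$ is a summand of $b\otimes c$.  Unless               *)
(* $a=b=c=\mathbf A$, each symbol occurs at most once in $a\otimes b\otimes c$,*)
(* and the identity has entries 1.  For $a=b=c=w=\mathbf A$ the matrix has its *)
(* columns indexed by $u$ and its rows by $v$, in the order 1, A.              *)
Definition assoc_coef (a b c u v w : sym) : C :=
  match a, b, c, w with
  | SA, SA, SA, SA =>
    match u, v with
    | S1, S1 => eps^-1
    | SA, S1 => x / sqrt_eps
    | S1, SA => (x * sqrt_eps)^-1
    | SA, SA => - eps^-1
    end
  | _, _, _, _ => 1
  end.

Definition eassoc X Y Z : ehom (etens (etens X Y) Z) (etens X (etens Y Z)) :=
  mkhom (fun p q =>
    let: (p', k, w) := label p in let: (i, j, u) := label p' in
    let: (i', q', w') := label q in let: (j', k', v) := label q' in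
    if [&& i == i', j == j', k == k' & w == w']
    then assoc_coef (summand X i) (summand Y j) (summand Z k) u v w else 0).

Definition braid_coef (a b w : sym) : C :=
  match a, b, w with
  | SA, SA, S1 => beta ^+ 2
  | SA, SA, SA => beta
  | _, _, _ => 1
  end.

Definition ebraid X Y : ehom (etens X Y) (etens Y X) :=
  mkhom (fun p q =>
    let: (i, j, w) := label p in let: (j', i', w') := label q in
    if [&& i == i', j == j' & w == w']
    then braid_coef (summand X i) (summand Y j) w else 0).

Definition etwist X : ehom X X :=
  mkhom (fun i j =>
    if i == j then (if summand X i is SA then beta ^- 2 else 1) else 0).

Definition ecoev X : ehom [:: S1] (etens X X) :=
  mkhom (fun _ q =>
    let: (i, j, w) := label q in
    if (i == j) && (w == S1)
    then (if summand X i is SA then y * sqrt_eps else y) else 0).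

Definition eev X : ehom (etens X X) [:: S1] :=
  mkhom (fun p _ =>
    let: (i, j, w) := label p in
    if (i == j) && (w == S1)
    then (if summand X i is SA then sqrt_eps / y else y^-1) else 0).

Definition catE : ribbon_data := {|
  obj := seq sym;
  mor := fun X Y => ehom X Y;
  idm := eid;
  compm := ecomp;
  tunit := [:: S1];
  tens := etens;
  tensm := etensm;
  assoc := eassoc;
  lunit := fun X => eid_cast (etens1s X);
  runit := fun X => eid_cast (etenss1 X);
  braid := ebraid;
  twist := etwist;
  dual := id;
  coev := ecoev;
  ev := eev |}.

Definition groundE (k : C) : mor (tunit : catE) tunit := mkhom (fun _ _ => k).

Definition simpleE (a : sym) : catE := [:: a].

End Constants.
End Morphisms.

Definition expi (R : realType) (t : R) : R[i] := Complex (cos t) (sin t).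

(* Main.v *)
Require Import Defs.
From mathcomp Require Import all_boot all_order all_algebra.
From mathcomp Require Import reals trigo.
From mathcomp Require Import complex ring lra.

Import Order.TTheory GRing.Theory Num.Theory.
Local Open Scope ring_scope.

(** A summand of a tensor product of several objects is reached by choosing
    one summand of each factor (the atoms) and then, for every bracket, the
    summand of the product of two symbols that one continues with (a fusion
    tree).  Here [stens a b] never repeats a symbol, so these choices are
    coordinates: this is what a [frame] records.  In such coordinates the
    associativity, the braiding, the twist and the identities are all local:
    they permute the atoms in a way that depends only on the bracketing, and
    for fixed atoms they are small matrices indexed by fusion trees.
    Composites and tensor products of local morphisms are local again
    ([is_local_comp], [is_local_tens]), so an equation between them splits into
    one equation between tree matrices for each choice of atoms, and this only
    depends on the symbols of the atoms.  The axioms thus become finitely many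
    scalar identities, and almost all of those hold by inspection.

    The others come from two quadratic equations.  The associativity matrix of
    three copies of A is an involution, and satisfies the pentagon, because
    [eps^2 = eps + 1].  The hexagons and the quantum trace of the double
    braiding of A with itself amount to [beta^2 = (1 - eps) beta - 1], that is,
    [beta + 1/beta = - 1/eps].  This determines [beta] up to inversion: [eps] is
    one of the two real roots of its equation, [1 - eps] is the other one, and
    twice the cosine of [pi/5], resp. of [3pi/5], is the positive, resp. the
    negative, root ([quadratic_beta]).

    The duality morphisms are not local, since they create and annihilate
    pairs of equal atoms.  In the zigzag identities the delta functions on atoms
    leave a single term, which is [y sqrt_eps * 1/eps * sqrt_eps/y] for the
    symbol A; in a quantum trace they leave the sum of the diagonal entries
    weighted by the dimensions [1] and [eps] of the symbols ([qtraceE]).  Hence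
    the matrix [S] has rows [(1, eps)] and [(eps, -1)], its square is the scalar
    [1 + eps^2], and this is nonzero because [eps] is real. *)

Set Implicit Arguments.
Unset Strict Implicit.
Unset Printing Implicit Defensive.

(** * Summands of a tensor product *)

Lemma summand1 a (i : 'I_1) : summand [:: a] i = a.
Proof. by rewrite ord1. Qed.

Lemma stens_uniq a b : uniq (stens a b).
Proof. by case: a; case: b. Qed.

Lemma stensr1 a : stens a S1 = [:: a].
Proof. by case: a. Qed.

Lemma labels_uniq X Y : uniq (labels X Y).
Proof.
have -> : labels X Y =
    [seq l | i <- enum 'I_(size X),
             l <- [seq (i, j, z) | j <- enum 'I_(size Y),
                                   z <- stens (summand X i) (summand Y j)]].
  by congr flatten; apply: eq_map => i; rewrite map_id.
apply: allpairs_uniq_dep => [|i _|[i l] [i' l']]; first exact: enum_uniq.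
  apply: allpairs_uniq_dep => [|j _|[j z] [j' z'] _ _ /= [-> ->] //].
    exact: enum_uniq.
  exact: stens_uniq.
move=> /allpairsPdep[a [b [_ + [-> ->]]]] /allpairsPdep[a' [b' [_ + [-> ->]]]].
move=> /allpairsPdep[j [z [_ _ e]]] /allpairsPdep[j' [z' [_ _ e']]] /= ebb'.
by move: e e'; rewrite -ebb' => -> [<-].
Qed.

Lemma mem_labels X Y (l : 'I_(size X) * 'I_(size Y) * sym) :
  (l \in labels X Y) = (l.2 \in stens (summand X l.1.1) (summand Y l.1.2)).
Proof.
case: l => -[i j] z /=.
apply/flatten_mapP/idP => [[i' _ /flatten_mapP[j' _]]|h].
  by move=> /mapP[z' + [-> -> ->]].
exists i; first by rewrite mem_enum.
apply/flatten_mapP; exists j; first by rewrite mem_enum.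
by apply/mapP; exists z.
Qed.

Lemma label_inj X Y : injective (@label X Y).
Proof.
have /tuple_uniqP inj : uniq (in_tuple (labels X Y)) by apply: labels_uniq.
by move=> p q /inj/cast_ord_inj.
Qed.

Lemma label_mem X Y p :
  (@label X Y p).2 \in stens (summand X (label p).1.1) (summand Y (label p).1.2).
Proof. by rewrite -mem_labels; apply: mem_tnth. Qed.

Lemma label_surj X Y (l : 'I_(size X) * 'I_(size Y) * sym) :
  l.2 \in stens (summand X l.1.1) (summand Y l.1.2) -> exists p, label p = l.
Proof.
rewrite -mem_labels => /(tnthP (in_tuple _)) [k ->].
by exists (cast_ord (esym (size_etens X Y)) k); rewrite /label cast_ordKV.
Qed.

Lemma summand_etens X Y p : summand (etens X Y) p = (label p).2.
Proof.
have lt : (p < size (labels X Y))%N by rewrite -size_etens.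
rewrite /summand (tnth_nth S1) /= -[X in nth _ X]labels_etens.
by rewrite (nth_map (label p)) //; congr _.2; rewrite [RHS](tnth_nth (label p)).
Qed.

Lemma label_unitl X (p : 'I_(size (etens [:: S1] X))) :
  (label p).1.2 = p :> nat.
Proof.
have e : labels [:: S1] X = [seq (ord0, i, summand X i) | i <- enum 'I_(size X)].
  rewrite /labels enum_ordSl enum_ord0 /= cats0.
  by rewrite -[RHS]flatten_map1; congr flatten; apply: eq_map => i.
have lt : (p < size X)%N by rewrite -[X in (_ < size X)%N]etens1s.
have h : label p = nth (label p) (labels [:: S1] X) p := tnth_nth (label p) _ _.
by rewrite h e (nth_map (Ordinal lt)) ?size_enum_ord //= nth_enum_ord.
Qed.

Lemma label_unitr X (p : 'I_(size (etens X [:: S1]))) :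
  (label p).1.1 = p :> nat.
Proof.
have e : labels X [:: S1] = [seq (i, ord0, summand X i) | i <- enum 'I_(size X)].
  rewrite /labels enum_ordSl enum_ord0 /=.
  rewrite -[RHS]flatten_map1; congr flatten; apply: eq_map => i.
  by rewrite cats0 /= stensr1.
have lt : (p < size X)%N by rewrite -[X in (_ < size X)%N]etenss1.
have h : label p = nth (label p) (labels X [:: S1]) p := tnth_nth (label p) _ _.
by rewrite h e (nth_map (Ordinal lt)) ?size_enum_ord //= nth_enum_ord.
Qed.

(** * Frames *)

(** The trees over given atoms form a sequence rather than a predicate: once
    the symbols of the atoms are concrete it computes to an explicit list, and
    sums over it to explicit scalars. *)
Record frame (X : seq sym) := Frame {
  atoms : finType;
  trees : finType;
  paths : atoms -> seq trees;
  col : atoms -> trees -> sym;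
  atom_of : 'I_(size X) -> atoms;
  tree_of : 'I_(size X) -> trees;
  frame_uniq : forall a, uniq (paths a);
  frame_mem : forall p, tree_of p \in paths (atom_of p);
  frame_col : forall p, summand X p = col (atom_of p) (tree_of p);
  frame_inj : forall p q,
    atom_of p = atom_of q -> tree_of p = tree_of q -> p = q;
  frame_surj : forall a t, t \in paths a ->
    exists p, atom_of p = a /\ tree_of p = t }.

#[local] Obligation Tactic := idtac.

Program Definition base X : frame X := {|
  atoms := 'I_(size X); trees := unit;
  paths := fun _ => [:: tt]; col := fun i _ => summand X i;
  atom_of := id; tree_of := fun _ => tt |}.
Next Obligation. by []. Qed.
Next Obligation. by []. Qed.
Next Obligation. by []. Qed.
Next Obligation. by []. Qed.
Next Obligation. by move=> X i []; exists i. Qed.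

Program Definition tensF X Y (F : frame X) (G : frame Y) :
    frame (etens X Y) := {|
  atoms := (atoms F * atoms G)%type;
  trees := (trees F * trees G * sym)%type;
  paths := fun a =>
    [seq (ts.1, ts.2, z) | ts <- [seq (t, s) | t <- paths a.1, s <- paths a.2],
                           z <- stens (col a.1 ts.1) (col a.2 ts.2)];
  col := fun _ t => t.2;
  atom_of := fun p => (atom_of F (label p).1.1, atom_of G (label p).1.2);
  tree_of := fun p =>
    (tree_of F (label p).1.1, tree_of G (label p).1.2, (label p).2) |}.
Next Obligation.
move=> X Y F G [a b].
apply: allpairs_uniq_dep => [|ts _|[[t s] z] [[t' s'] z'] _ _ /= [-> -> ->] //].
  by apply: allpairs_uniq; rewrite ?frame_uniq // => -[t s] [t' s'].
exact: stens_uniq.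
Qed.
Next Obligation.
move=> X Y F G p; apply/allpairsPdep.
exists (tree_of F (label p).1.1, tree_of G (label p).1.2), (label p).2.
split=> //; last by rewrite -!frame_col label_mem.
by apply: allpairs_f; apply: frame_mem.
Qed.
Next Obligation. by move=> X Y F G p; apply: summand_etens. Qed.
Next Obligation.
move=> X Y F G p q [ea eb] [et es ez]; apply: label_inj.
move: ea eb et es ez.
case: (label p) => -[i j] z; case: (label q) => -[i' j'] z' /=.
by move=> /frame_inj ea /frame_inj eb /ea -> /eb -> ->.
Qed.
Next Obligation.
move=> X Y F G [a b] r.
move=> /allpairsPdep[_ [z [/allpairsP[[t s] /= [vt vs ->]] vz {r}->]]].
have [i [ei ei']] := frame_surj vt; have [j [ej ej']] := frame_surj vs.
have [|p ep] := @label_surj X Y (i, j, z).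
  by rewrite /= (frame_col F) (frame_col G) ei ei' ej ej'.
by exists p; rewrite ep /= ei ei' ej ej'.
Qed.

Lemma frame_eq X (F : frame X) p q :
  (p == q) = (atom_of F p == atom_of F q) && (tree_of F p == tree_of F q).
Proof.
apply/eqP/andP => [->|[/eqP ea /eqP et]]; first by rewrite !eqxx.
exact: frame_inj ea et.
Qed.

(** * Checking statements on explicit lists of trees *)

Fixpoint allP (T : Type) (P : T -> Prop) (s : seq T) : Prop :=
  if s is t :: s' then P t /\ allP P s' else True.

Lemma in_allP (T : eqType) (P : T -> Prop) s : allP P s -> {in s, forall t, P t}.
Proof.
elim: s => //= t s IH [Pt /IH Ps] r; rewrite inE => /predU1P[->//|].
exact: Ps.
Qed.

(** The left-hand side is a conjunction as soon as the lists are explicit. *)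
Lemma in_allP2 (T S : eqType) (P : T -> S -> Prop) s r :
  allP (fun t => allP (P t) r) s -> {in s & r, forall t u, P t u}.
Proof.
move=> h t u ts ur; move: t ts u ur; apply: in_allP.
by elim: s h => //= t s IH [/in_allP h /IH].
Qed.

(** * Kernels of morphisms *)

Section Kernels.
Variable C : fieldType.
Implicit Types X Y Z T : seq sym.

Local Notation "f ;; g" := (ecomp f g).
Local Notation "f \otm g" := (etensm f g).
Local Notation id_ := (eid C).
Local Notation lunit X := (eid_cast C (etens1s X)).
Local Notation runit X := (eid_cast C (etenss1 X)).

Lemma ehom_ext X Y (f g : ehom C X Y) :
  (forall p q, ehom_mx f p q = ehom_mx g p q) -> f = g.
Proof. by move=> e; apply/val_inj/matrixP. Qed.

Lemma ehomD X Y (f g : ehom C X Y) p q :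
  ehom_mx (f + g) p q = ehom_mx f p q + ehom_mx g p q.
Proof. by rewrite -[LHS]/((ehom_mx f + ehom_mx g) p q) mxE. Qed.

Lemma ehom_supp0 X Y (f : ehom C X Y) i j :
  summand X i != summand Y j -> ehom_mx f i j = 0.
Proof. by move/(supportedP _ (ehom_supported f)). Qed.

(** This sum is used instead of a [bigop] where its list will become explicit,
    because it reduces by computation. *)
Definition sum_over (T : Type) (s : seq T) (F : T -> C) : C :=
  foldr (fun t r => F t + r) 0 s.

Lemma sum_overE (T : Type) (s : seq T) (F : T -> C) :
  sum_over s F = \sum_(t <- s) F t.
Proof. by elim: s => [|t s IH]; rewrite ?big_nil ?big_cons //= IH. Qed.

Lemma frame_sum X (F : frame X) (H : atoms F -> trees F -> C) :
  \sum_p H (atom_of F p) (tree_of F p) = \sum_a \sum_(t <- paths a) H a t.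
Proof.
under [RHS]eq_bigr => a _ do rewrite big_uniq ?frame_uniq //=.
rewrite pair_big_dep /=.
rewrite -(big_imset (h := fun p => (atom_of F p, tree_of F p))
                    (fun c => H c.1 c.2)) /=.
  apply: eq_bigl => -[a t] /=.
  apply/imsetP/idP => [[p _ [-> ->]]|/frame_surj[p [<- <-]]].
    exact: frame_mem.
  by exists p.
by move=> p q _ _ []; apply: frame_inj.
Qed.

Definition has_kernel X Y (F : frame X) (G : frame Y) (f : ehom C X Y)
    (K : atoms F -> trees F -> atoms G -> trees G -> C) : Prop :=
  forall p q,
    ehom_mx f p q = K (atom_of F p) (tree_of F p) (atom_of G q) (tree_of G q).
Arguments has_kernel {X Y} F G f K.

Lemma kernel_ext X Y (F : frame X) (G : frame Y) f g K L :
  has_kernel F G f K -> has_kernel F G g L ->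
  (forall a b, {in paths a & paths b, forall t s, K a t b s = L a t b s}) ->
  f = g.
Proof.
move=> fK gL e; apply: ehom_ext => p q.
by rewrite fK gL e ?frame_mem.
Qed.

Lemma kernel_base X Y (f : ehom C X Y) :
  has_kernel (base X) (base Y) f (fun i _ j _ => ehom_mx f i j).
Proof. by []. Qed.

Lemma kernel_comp X Y Z (F : frame X) (G : frame Y) (H : frame Z) f g K L :
  has_kernel F G f K -> has_kernel G H g L ->
  has_kernel F H (f ;; g)
    (fun a t c r => \sum_b \sum_(s <- paths b) K a t b s * L b s c r).
Proof.
move=> fK gL p q; rewrite mxE -(frame_sum (fun b s => K _ _ b s * L b s _ _)).
by apply: eq_bigr => r _; rewrite fK gL.
Qed.

(** The condition on the symbols of the atoms in the definition of [etensm]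
    has disappeared: where it fails, one of the two factors vanishes. *)
Lemma kernel_tens X Y Z T (F : frame X) (G : frame Y) (F' : frame Z)
    (G' : frame T) f g K L :
  has_kernel F G f K -> has_kernel F' G' g L ->
  has_kernel (tensF F F') (tensF G G') (f \otm g)
    (fun a t b s =>
       if t.2 == s.2 then K a.1 t.1.1 b.1 s.1.1 * L a.2 t.1.2 b.2 s.1.2 else 0).
Proof.
move=> fK gL p q; rewrite mxE !summand_etens /=.
case: (label p) => -[i r] z; case: (label q) => -[j s] t /=.
case: eqP => // _; rewrite andbT -fK -gL.
case: eqP => [_|/eqP/ehom_supp0->]; last by rewrite mul0r.
by case: eqP => [_|/eqP/ehom_supp0->] //=; rewrite mulr0.
Qed.

(** * Local morphisms *)

Definition is_local X Y (F : frame X) (G : frame Y) (f : ehom C X Y)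
    (u : atoms F -> atoms G) (K : atoms F -> trees F -> trees G -> C) : Prop :=
  has_kernel F G f (fun a t b s => if u a == b then K a t s else 0).
Arguments is_local {X Y} F G f u K.

Lemma local_ext X Y (F : frame X) (G : frame Y) f g u v K L :
  is_local F G f u K -> is_local F G g v L ->
  u =1 v ->
  (forall a, {in paths a & paths (u a), forall t s, K a t s = L a t s}) -> f = g.
Proof.
move=> fK gL uv KL; apply: (kernel_ext fK gL) => a b t s vt vs.
by rewrite -uv; case: eqP => // e; apply: KL; rewrite // e.
Qed.

Lemma kernel_local_l X Y Z (F : frame X) (G : frame Y) (H : frame Z) f g u K L :
  is_local F G f u K -> has_kernel G H g L ->
  has_kernel F H (f ;; g)
    (fun a t c r => sum_over (paths (u a)) (fun s => K a t s * L (u a) s c r)).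
Proof.
move=> fK gL p q; rewrite (kernel_comp fK gL) sum_overE.
rewrite (bigD1 (u (atom_of F p))) //= eqxx.
rewrite [X in _ + X]big1 ?addr0 // => b ne; rewrite big1 // => s _.
by rewrite eq_sym (negbTE ne) mul0r.
Qed.

Lemma kernel_local_r X Y Z (F : frame X) (G : frame Y) (H : frame Z) f g v v' K L :
  has_kernel F G f K -> is_local G H g v L -> cancel v v' -> cancel v' v ->
  has_kernel F H (f ;; g)
    (fun a t c r =>
       sum_over (paths (v' c)) (fun s => K a t (v' c) s * L (v' c) s r)).
Proof.
move=> fK gL vK v'K p q; rewrite (kernel_comp fK gL) sum_overE.
rewrite (bigD1 (v' (atom_of H q))) //= v'K eqxx.
rewrite [X in _ + X]big1 ?addr0 // => b ne; rewrite big1 // => s _.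
by case: eqP => [e|]; rewrite ?mulr0 // -e vK eqxx in ne *.
Qed.

Lemma is_local_comp X Y Z (F : frame X) (G : frame Y) (H : frame Z) f g u v K L :
  is_local F G f u K -> is_local G H g v L ->
  is_local F H (f ;; g) (v \o u)
    (fun a t r => sum_over (paths (u a)) (fun s => K a t s * L (u a) s r)).
Proof.
move=> fK gL p q; rewrite (kernel_local_l fK gL) /=.
by case: eqP => // _; rewrite sum_overE big1 // => s _; rewrite mulr0.
Qed.

Lemma is_local_tens X Y Z T (F : frame X) (G : frame Y) (F' : frame Z)
    (G' : frame T) f g u v K L :
  is_local F G f u K -> is_local F' G' g v L ->
  is_local (tensF F F') (tensF G G') (f \otm g) (fun a => (u a.1, v a.2))
    (fun a t s =>
       if t.2 == s.2 then K a.1 t.1.1 s.1.1 * L a.2 t.1.2 s.1.2 else 0).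
Proof.
move=> fK gL p q; rewrite (kernel_tens fK gL) /= xpair_eqE.
by do 3!case: ifP => //=; rewrite ?mulr0 ?mul0r.
Qed.

Lemma local_id X (F : frame X) :
  is_local F F (id_ X) id (fun a t s => if t == s then 1 else 0).
Proof.
move=> p q; rewrite mxE (frame_eq F) !(frame_col F) /=.
by do !case: eqP => //=; congruence.
Qed.

Lemma eid_castE X Y (e : X = Y) p q :
  ehom_mx (eid_cast C e) p q = (p == q :> nat)%:R.
Proof.
case: Y / e q => q; rewrite mxE; case: eqP => // /eqP ne.
by case: eqP => // /val_inj e; rewrite e eqxx in ne.
Qed.

Lemma local_lunit X :
  is_local (tensF (base [:: S1]) (base X)) (base X) (lunit X)
    (fun a => a.2) (fun _ _ _ => 1).
Proof.
by move=> p q; rewrite eid_castE -label_unitl val_eqE /=; case: eqP.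
Qed.

Lemma local_runit X :
  is_local (tensF (base X) (base [:: S1])) (base X) (runit X)
    (fun a => a.1) (fun _ _ _ => 1).
Proof.
by move=> p q; rewrite eid_castE -label_unitr val_eqE /=; case: eqP.
Qed.

(** * Category and tensor product *)

(* Equality tests between concrete trees only reduce once [eq_op] is unfolded. *)
Ltac compute_trees :=
  rewrite /sum_over /=; rewrite /eq_op /=; rewrite ?mul1r ?mulr1 ?addr0;
  try by [];
  rewrite ?mul0r ?mulr0 ?add0r ?addr0; try by [].

(* [e] says that an entry vanishes; both sides have it as a factor in every
   term. *)
Ltac vanish e :=
  rewrite ?sum_overE; rewrite ?big1 => *;
  rewrite /= ?e ?(mul0r, mulr0, addr0, if_same) //.

Lemma ecompA X Y Z T (f : ehom C X Y) (g : ehom C Y Z) (h : ehom C Z T) :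
  (f ;; g) ;; h = f ;; (g ;; h).
Proof. by apply/val_inj/esym/mulmxA. Qed.

Lemma eid_mx X : ehom_mx (id_ X) = 1%:M.
Proof.
apply/matrixP => i j; rewrite !mxE.
by case: (i =P j) => [->|_]; rewrite ?eqxx ?if_same.
Qed.

Lemma ecomp1f X Y (f : ehom C X Y) : id_ X ;; f = f.
Proof. by apply/val_inj; rewrite -[RHS]mul1mx -eid_mx. Qed.

Lemma ecompf1 X Y (f : ehom C X Y) : f ;; id_ Y = f.
Proof. by apply/val_inj; rewrite -[RHS]mulmx1 -eid_mx. Qed.

Lemma ecompDl X Y Z (f f' : ehom C X Y) (g : ehom C Y Z) :
  (f + f') ;; g = f ;; g + f' ;; g.
Proof. by apply/val_inj/mulmxDl. Qed.

Lemma ecompDr X Y Z (f : ehom C X Y) (g g' : ehom C Y Z) :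
  f ;; (g + g') = f ;; g + f ;; g'.
Proof. by apply/val_inj/mulmxDr. Qed.

Lemma etensmDl X Y Z T (f f' : ehom C X Y) (g : ehom C Z T) :
  (f + f') \otm g = f \otm g + f' \otm g.
Proof.
apply: ehom_ext => p q.
rewrite ehomD !(kernel_tens (kernel_base _) (kernel_base _)) /= ehomD.
by case: ifP; rewrite ?addr0 ?mulrDl.
Qed.

Lemma etensmDr X Y Z T (f : ehom C X Y) (g g' : ehom C Z T) :
  f \otm (g + g') = f \otm g + f \otm g'.
Proof.
apply: ehom_ext => p q.
rewrite ehomD !(kernel_tens (kernel_base _) (kernel_base _)) /= ehomD.
by case: ifP; rewrite ?addr0 ?mulrDr.
Qed.

Lemma etensm_id X Y : id_ X \otm id_ Y = id_ (etens X Y).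
Proof.
apply: (local_ext (is_local_tens (local_id (base X)) (local_id (base Y)))
                  (local_id (tensF (base X) (base Y)))) => [[]//|].
move=> [i j]; apply: in_allP2 => /=.
by case: (summand X i); case: (summand Y j) => /=; repeat split; compute_trees.
Qed.

(** Both sides are sums over pairs of intermediate summands.  On the right there
    is a further sum over the summand of their product, and it has exactly one
    nonzero term, because that summand is also the one at the source. *)
Lemma etensm_comp X Y Z X' Y' Z' (f : ehom C X Y) (g : ehom C Y Z)
    (f' : ehom C X' Y') (g' : ehom C Y' Z') :
  (f ;; g) \otm (f' ;; g') = (f \otm f') ;; (g \otm g').
Proof.
apply: (kernel_ext
  (kernel_tens (kernel_comp (kernel_base f) (kernel_base g))
               (kernel_comp (kernel_base f') (kernel_base g')))
  (kernel_comp (kernel_tens (kernel_base f) (kernel_base f'))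
               (kernel_tens (kernel_base g) (kernel_base g')))).
move=> [i i'] [k k'] [[[] []] z] [[[] []] z'] /= zP _.
under [in LHS]eq_bigr => j _ do rewrite big_seq1.
under [in X in _ * X]eq_bigr => j _ do rewrite big_seq1.
rewrite big_distrlr /= pair_big /=.
have -> (c : C) : (if z == z' then c else 0) = (z == z')%:R * c.
  by case: eqP; rewrite ?mul1r ?mul0r.
rewrite big_distrr; apply: eq_bigr => -[j j'] _ /=.
have [e|/ehom_supp0 e] := eqVneq (summand X i) (summand Y j); last by vanish e.
have [e'|/ehom_supp0 e'] := eqVneq (summand X' i') (summand Y' j');
  last by vanish e'.
rewrite -sum_overE -e -e'.
move: z z' zP {e e'}.
by case: (summand X i); case: (summand X' i') => -[] [] //= _;
  compute_trees; ring.
Qed.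

Lemma eid_castK X Y (e : X = Y) :
  eid_cast C e ;; eid_cast C (esym e) = id_ X
  /\ eid_cast C (esym e) ;; eid_cast C e = id_ Y.
Proof. by case: Y / e; rewrite /= !ecomp1f. Qed.

Lemma elunit_nat X Y (f : ehom C X Y) :
  (id_ [:: S1] \otm f) ;; lunit Y = lunit X ;; f.
Proof.
apply: (kernel_ext
  (kernel_local_r (G := tensF (base [:: S1]) (base Y)) (v' := fun j => (ord0, j))
     (kernel_tens (local_id (base [:: S1])) (kernel_base f)) (local_lunit (X := Y))
     _ _)
  (kernel_local_l (local_lunit (X := X)) (kernel_base f))) => [[i j] /=|//|].
  by rewrite (ord1 i).
move=> [i j] j' t s /=.
have [e|/ehom_supp0 e] := eqVneq (summand X j) (summand Y j'); last by vanish e.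
rewrite (ord1 i) summand1 -e; move: t s; apply: in_allP2 => /=.
by case: (summand X j) => /=; repeat split; compute_trees.
Qed.

Lemma erunit_nat X Y (f : ehom C X Y) :
  (f \otm id_ [:: S1]) ;; runit Y = runit X ;; f.
Proof.
apply: (kernel_ext
  (kernel_local_r (G := tensF (base Y) (base [:: S1])) (v' := fun j => (j, ord0))
     (kernel_tens (kernel_base f) (local_id (base [:: S1]))) (local_runit (X := Y))
     _ _)
  (kernel_local_l (local_runit (X := X)) (kernel_base f))) => [[j i] /=|//|].
  by rewrite (ord1 i).
move=> [j i] j' t s /=.
have [e|/ehom_supp0 e] := eqVneq (summand X j) (summand Y j'); last by vanish e.
rewrite (ord1 i) summand1 -e; move: t s; apply: in_allP2 => /=.
by case: (summand X j) => /=; repeat split; compute_trees.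
Qed.

Section Constants.
Variables eps sqrt_eps x y beta : C.

Local Notation alpha := (eassoc eps sqrt_eps x).
Local Notation braid := (ebraid beta).
Local Notation twist := (etwist beta).
Local Notation coev := (ecoev sqrt_eps y).
Local Notation ev := (eev sqrt_eps y).

(** * The structure morphisms in coordinates *)

Lemma local_assoc X Y Z (F : frame X) (G : frame Y) (H : frame Z) :
  is_local (tensF (tensF F G) H) (tensF F (tensF G H)) (alpha X Y Z)
    (fun a => (a.1.1, (a.1.2, a.2)))
    (fun a t s =>
       if [&& t.1.1.1.1 == s.1.1, t.1.1.1.2 == s.1.2.1.1,
              t.1.2 == s.1.2.1.2 & t.2 == s.2]
       then assoc_coef eps sqrt_eps x (col a.1.1 t.1.1.1.1)
              (col a.1.2 t.1.1.1.2) (col a.2 t.1.2) t.1.1.2 s.1.2.2 t.2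
       else 0).
Proof.
move=> p q; rewrite mxE !summand_etens /=.
case: (label p) => -[p' k] w; case: (label q) => -[i' q'] w' /=.
case: (label p') => -[i j] s; case: (label q') => -[j' k'] v /=.
rewrite !xpair_eqE (frame_eq F) (frame_eq G) (frame_eq H).
rewrite (frame_col F) (frame_col G) (frame_col H).
by do !case: eqP => //=.
Qed.

(** The 2 x 2 matrix in [assoc_coef] is an involution, so the inverse has the
    same coefficients with the two inner labels exchanged. *)
Definition eassoc_inv X Y Z :
    ehom C (etens X (etens Y Z)) (etens (etens X Y) Z) :=
  mkhom (fun q p =>
    let: (p', k, w) := label p in let: (i, j, u) := label p' in
    let: (i', q', w') := label q in let: (j', k', v) := label q' in
    if [&& i == i', j == j', k == k' & w == w']
    then assoc_coef eps sqrt_eps x (summand X i) (summand Y j) (summand Z k) v u w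
    else 0).

Lemma local_assoc_inv X Y Z (F : frame X) (G : frame Y) (H : frame Z) :
  is_local (tensF F (tensF G H)) (tensF (tensF F G) H) (eassoc_inv X Y Z)
    (fun a => ((a.1, a.2.1), a.2.2))
    (fun a s t =>
       if [&& s.1.1 == t.1.1.1.1, s.1.2.1.1 == t.1.1.1.2,
              s.1.2.1.2 == t.1.2 & s.2 == t.2]
       then assoc_coef eps sqrt_eps x (col a.1 s.1.1) (col a.2.1 s.1.2.1.1)
              (col a.2.2 s.1.2.1.2) s.1.2.2 t.1.1.2 t.2
       else 0).
Proof.
move=> q p; rewrite mxE !summand_etens /=.
case: (label p) => -[p' k] w; case: (label q) => -[i' q'] w' /=.
case: (label p') => -[i j] s; case: (label q') => -[j' k'] v /=.
rewrite !xpair_eqE (frame_eq F) (frame_eq G) (frame_eq H).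
rewrite (frame_col F) (frame_col G) (frame_col H).
by do !case: eqP => //=; congruence.
Qed.

Lemma local_braid b X Y (F : frame X) (G : frame Y) :
  is_local (tensF F G) (tensF G F) (ebraid b X Y) (fun a => (a.2, a.1))
    (fun a t s =>
       if [&& t.1.1 == s.1.2, t.1.2 == s.1.1 & t.2 == s.2]
       then braid_coef b (col a.1 t.1.1) (col a.2 t.1.2) t.2 else 0).
Proof.
move=> p q; rewrite mxE !summand_etens /=.
case: (label p) => -[i j] w; case: (label q) => -[j' i'] w' /=.
rewrite !xpair_eqE (frame_eq F) (frame_eq G) (frame_col F) (frame_col G).
by do !case: eqP => //=.
Qed.

Definition twist_coef (b : C) (a : sym) : C := if a is SA then b ^- 2 else 1.

Lemma local_twist b X (F : frame X) :
  is_local F F (etwist b X) id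
    (fun a t s => if t == s then twist_coef b (col a t) else 0).
Proof.
move=> p q; rewrite mxE (frame_eq F) !(frame_col F) /=.
by do !case: eqP => //=; congruence.
Qed.

Definition coev_coef (a : sym) : C := if a is SA then y * sqrt_eps else y.
Definition ev_coef (a : sym) : C := if a is SA then sqrt_eps / y else y^-1.

Lemma kernel_coev X (F : frame X) :
  has_kernel (base [:: S1]) (tensF F F) (coev X)
    (fun _ _ b s => if [&& b.1 == b.2, s.1.1 == s.1.2 & s.2 == S1]
       then coev_coef (col b.1 s.1.1) else 0).
Proof.
move=> p q; rewrite mxE !summand_etens summand1 /=.
case: (label q) => -[j' i'] w' /=; rewrite (frame_eq F) (frame_col F).
by do !case: eqP => //=; congruence.
Qed.

Lemma kernel_ev X (F : frame X) :
  has_kernel (tensF F F) (base [:: S1]) (ev X)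
    (fun b s _ _ => if [&& b.1 == b.2, s.1.1 == s.1.2 & s.2 == S1]
       then ev_coef (col b.1 s.1.1) else 0).
Proof.
move=> p q; rewrite mxE !summand_etens summand1 /=.
case: (label p) => -[j' i'] w' /=; rewrite (frame_eq F) (frame_col F).
by do !case: eqP => //=; congruence.
Qed.

(** * Naturality and the laws that hold for all constants *)

Lemma eassoc_nat X Y Z X' Y' Z'
    (f : ehom C X X') (g : ehom C Y Y') (h : ehom C Z Z') :
  ((f \otm g) \otm h) ;; alpha X' Y' Z' = alpha X Y Z ;; (f \otm (g \otm h)).
Proof.
apply: (kernel_ext
  (kernel_local_r (G := tensF (tensF (base X') (base Y')) (base Z'))
     (H := tensF (base X') (tensF (base Y') (base Z')))
     (v' := fun c => ((c.1, c.2.1), c.2.2))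
     (kernel_tens (kernel_tens (kernel_base f) (kernel_base g)) (kernel_base h))
     (local_assoc (base X') (base Y') (base Z')) _ _)
  (kernel_local_l (local_assoc (base X) (base Y) (base Z))
     (kernel_tens (kernel_base f) (kernel_tens (kernel_base g) (kernel_base h)))))
  => [[[]]//|[?[]]//|].
move=> [[i j] k] [i' [j' k']] t s /=.
have [e|/ehom_supp0 e] := eqVneq (summand X i) (summand X' i'); last by vanish e.
have [e'|/ehom_supp0 e'] := eqVneq (summand Y j) (summand Y' j');
  last by vanish e'.
have [e''|/ehom_supp0 e''] := eqVneq (summand Z k) (summand Z' k');
  last by vanish e''.
rewrite -e -e' -e'' {e e' e''}; move: t s; apply: in_allP2 => /=.
by case: (summand X i); case: (summand Y j); case: (summand Z k) => /=;
  repeat split; compute_trees; ring.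
Qed.

Lemma ebraid_nat X Y X' Y' (f : ehom C X X') (g : ehom C Y Y') :
  (f \otm g) ;; braid X' Y' = braid X Y ;; (g \otm f).
Proof.
apply: (kernel_ext
  (kernel_local_r (G := tensF (base X') (base Y'))
     (H := tensF (base Y') (base X')) (v' := fun c => (c.2, c.1))
     (kernel_tens (kernel_base f) (kernel_base g))
     (local_braid beta (base X') (base Y')) _ _)
  (kernel_local_l (local_braid beta (base X) (base Y))
     (kernel_tens (kernel_base g) (kernel_base f)))) => [[]//|[]//|].
move=> [i j] [j' i'] t s /=.
have [e|/ehom_supp0 e] := eqVneq (summand X i) (summand X' i'); last by vanish e.
have [e'|/ehom_supp0 e'] := eqVneq (summand Y j) (summand Y' j');
  last by vanish e'.
rewrite -e -e' {e e'}; move: t s; apply: in_allP2 => /=.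
by case: (summand X i); case: (summand Y j) => /=;
  repeat split; compute_trees; ring.
Qed.

Lemma etwist_nat X Y (f : ehom C X Y) : f ;; twist Y = twist X ;; f.
Proof.
apply: (kernel_ext
  (kernel_local_r (v' := id) (kernel_base f) (local_twist beta (base Y)) _ _)
  (kernel_local_l (local_twist beta (base X)) (kernel_base f))) => //.
move=> i j t s /=.
have [e|/ehom_supp0 e] := eqVneq (summand X i) (summand Y j); last by vanish e.
rewrite -e; move: t s; apply: in_allP2 => /=.
by case: (summand X i) => /=; repeat split; compute_trees; ring.
Qed.

Lemma etriangle X Y :
  alpha X [:: S1] Y ;; (id_ X \otm lunit Y) = runit X \otm id_ Y.
Proof.
apply: (local_ext
  (is_local_comp (local_assoc (base X) (base [:: S1]) (base Y))
     (is_local_tens (local_id (base X)) (local_lunit (X := Y))))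
  (is_local_tens (local_runit (X := X)) (local_id (base Y)))) => [[[]]//|].
move=> [[i j] k]; apply: in_allP2 => /=; rewrite summand1.
by case: (summand X i); case: (summand Y k) => /=; repeat split; compute_trees.
Qed.

Lemma ebraidK b X Y : b != 0 -> ebraid b X Y ;; ebraid b^-1 Y X = id_ _.
Proof.
move=> b0; apply: (local_ext
  (is_local_comp (local_braid b (base X) (base Y))
                 (local_braid b^-1 (base Y) (base X)))
  (local_id (tensF (base X) (base Y)))) => [[]//|].
move=> [i j]; apply: in_allP2 => /=.
by case: (summand X i); case: (summand Y j) => /=;
  repeat split; compute_trees; field; rewrite b0 ?oner_eq0.
Qed.

Lemma etwistK b X : b != 0 -> etwist b X ;; etwist b^-1 X = id_ X.
Proof.
move=> b0; apply: (local_ext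
  (is_local_comp (local_twist b (base X)) (local_twist b^-1 (base X)))
  (local_id (base X))) => //=.
move=> i; apply: in_allP2 => /=.
by case: (summand X i) => /=;
  repeat split; compute_trees; field; rewrite b0 ?oner_eq0.
Qed.

(** On the summands 1 and A of the product of two copies of A, the double
    braiding is [beta^4] and [beta^2], which turns the product [beta^-4] of the
    twists into the twists [1] and [beta^-2]. *)
Lemma etwist_tens X Y : beta != 0 ->
  twist (etens X Y) = (twist X \otm twist Y) ;; braid X Y ;; braid Y X.
Proof.
move=> b0; apply: (local_ext (local_twist beta (tensF (base X) (base Y)))
  (is_local_comp
     (is_local_comp
        (is_local_tens (local_twist beta (base X)) (local_twist beta (base Y)))
        (local_braid beta (base X) (base Y)))
     (local_braid beta (base Y) (base X)))) => [[]//|].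
move=> [i j]; apply: in_allP2 => /=.
by case: (summand X i); case: (summand Y j) => /=;
  repeat split; compute_trees; field; rewrite ?b0 ?oner_eq0.
Qed.

Lemma ecoev_twist X :
  coev X ;; (twist X \otm id_ X) = coev X ;; (id_ X \otm twist X).
Proof.
pose F := base X.
apply: (kernel_ext
  (kernel_local_r (v' := id) (kernel_coev F)
     (is_local_tens (local_twist beta F) (local_id F)) _ _)
  (kernel_local_r (v' := id) (kernel_coev F)
     (is_local_tens (local_id F) (local_twist beta F)) _ _)); try by case.
move=> a [i j] /=.
have [<-|ne] := eqVneq i j; last first.
  by move=> t s _ _; rewrite !sum_overE !big1 // => *; rewrite mul0r.
apply: in_allP2 => /=.
by case: (summand X i) => /=; repeat split; compute_trees.
Qed.

(** * Associativity *)

Hypotheses (heps : eps ^+ 2 = eps + 1) (hsqrt : sqrt_eps ^+ 2 = eps).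

Lemma eps_neq0 : eps != 0.
Proof.
apply/eqP => e; move: heps; rewrite e expr2 mul0r add0r => /eqP.
by rewrite eq_sym oner_eq0.
Qed.

Lemma sqrt_eps_neq0 : sqrt_eps != 0.
Proof. by move: eps_neq0; rewrite -hsqrt expf_eq0. Qed.

Section Associativity.
Hypothesis hx : x != 0.

Ltac golden := field: heps hsqrt; by rewrite ?hx ?eps_neq0 ?sqrt_eps_neq0.

Lemma eassocK X Y Z : alpha X Y Z ;; eassoc_inv X Y Z = id_ _.
Proof.
apply: (local_ext
  (is_local_comp (local_assoc (base X) (base Y) (base Z))
                 (local_assoc_inv (base X) (base Y) (base Z)))
  (local_id (tensF (tensF (base X) (base Y)) (base Z)))) => [[[]]//|].
move=> [[i j] k]; apply: in_allP2 => /=.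
by case: (summand X i); case: (summand Y j); case: (summand Z k) => /=;
  repeat split; compute_trees; golden.
Qed.

Lemma eassoc_invK X Y Z : eassoc_inv X Y Z ;; alpha X Y Z = id_ _.
Proof.
apply: (local_ext
  (is_local_comp (local_assoc_inv (base X) (base Y) (base Z))
                 (local_assoc (base X) (base Y) (base Z)))
  (local_id (tensF (base X) (tensF (base Y) (base Z))))) => [[?[]]//|].
move=> [i [j k]]; apply: in_allP2 => /=.
by case: (summand X i); case: (summand Y j); case: (summand Z k) => /=;
  repeat split; compute_trees; golden.
Qed.

(** If one of the atoms is 1, both sides have literally the same entries.  For
    four atoms A they are 2 x 2 matrices for the total symbol 1 and 3 x 3
    matrices for the total symbol A, which agree by [eps^2 = eps + 1]. *)
Lemma epentagon X Y Z T :
  alpha (etens X Y) Z T ;; alpha X Y (etens Z T)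
  = (alpha X Y Z \otm id_ T) ;; alpha X (etens Y Z) T
      ;; (id_ X \otm alpha Y Z T).
Proof.
pose X' := base X; pose Y' := base Y; pose Z' := base Z; pose T' := base T.
apply: (local_ext
  (is_local_comp (local_assoc (tensF X' Y') Z' T')
                 (local_assoc X' Y' (tensF Z' T')))
  (is_local_comp
    (is_local_comp (is_local_tens (local_assoc X' Y' Z') (local_id T'))
                   (local_assoc X' (tensF Y' Z') T'))
    (is_local_tens (local_id X') (local_assoc Y' Z' T')))) => //=.
move=> [[[i j] k] l]; apply: in_allP2 => /=.
by case: (summand X i); case: (summand Y j); case: (summand Z k);
  case: (summand T l) => /=; repeat split; compute_trees; golden.
Qed.

(** * Braiding *)

Hypothesis hbeta : beta ^+ 2 = (1 - eps) * beta - 1.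

Ltac golden_braid :=
  field: heps hsqrt hbeta; by rewrite ?hx ?eps_neq0 ?sqrt_eps_neq0.

(** With [M] the associativity matrix of three copies of A, the nontrivial case
    is [M diag(1, beta) M = diag(beta^2, beta) M diag(beta^2, beta)]. *)
Lemma ehexagon1 X Y Z :
  alpha X Y Z ;; braid X (etens Y Z) ;; alpha Y Z X
  = (braid X Y \otm id_ Z) ;; alpha Y X Z ;; (id_ Y \otm braid X Z).
Proof.
pose X' := base X; pose Y' := base Y; pose Z' := base Z.
apply: (local_ext
  (is_local_comp
     (is_local_comp (local_assoc X' Y' Z') (local_braid beta X' (tensF Y' Z')))
     (local_assoc Y' Z' X'))
  (is_local_comp
     (is_local_comp (is_local_tens (local_braid beta X' Y') (local_id Z'))
                    (local_assoc Y' X' Z'))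
     (is_local_tens (local_id Y') (local_braid beta X' Z')))) => //=.
move=> [[i j] k]; apply: in_allP2 => /=.
by case: (summand X i); case: (summand Y j); case: (summand Z k) => /=;
  repeat split; compute_trees; golden_braid.
Qed.

Lemma ehexagon2 X Y Z :
  braid (etens X Y) Z =
  alpha X Y Z ;; (id_ X \otm braid Y Z) ;; eassoc_inv X Z Y
    ;; (braid X Z \otm id_ Y) ;; alpha Z X Y.
Proof.
pose X' := base X; pose Y' := base Y; pose Z' := base Z.
apply: (local_ext
  (local_braid beta (tensF X' Y') Z')
  (is_local_comp
     (is_local_comp
        (is_local_comp
           (is_local_comp (local_assoc X' Y' Z')
              (is_local_tens (local_id X') (local_braid beta Y' Z')))
           (local_assoc_inv X' Z' Y'))
        (is_local_tens (local_braid beta X' Z') (local_id Y')))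
     (local_assoc Z' X' Y'))) => [[[]]//|].
move=> [[i j] k]; apply: in_allP2 => /=.
by case: (summand X i); case: (summand Y j); case: (summand Z k) => /=;
  repeat split; compute_trees; golden_braid.
Qed.

End Associativity.

(** * Duality *)

Hypothesis hy : y != 0.

(** The pair created by [coev] has equal atoms, the pair annihilated by [ev]
    has equal atoms, and the identity factors preserve theirs: all atoms of the
    intermediate product are equal to the one at the target. *)
Lemma ezigzag1 X :
  (coev X \otm id_ X) ;; alpha X X X ;; (id_ X \otm ev X) ;; runit X = lunit X.
Proof.
pose F := base X.
apply: (kernel_ext (F := tensF (base [:: S1]) F) (G := F)
  (kernel_local_r (G := tensF F (base [:: S1])) (v' := fun i => (i, ord0))
     (kernel_comp
        (kernel_local_r (G := tensF (tensF F F) F) (H := tensF F (tensF F F))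
           (v' := fun c => ((c.1, c.2.1), c.2.2))
           (kernel_tens (kernel_coev F) (local_id F)) (local_assoc F F F) _ _)
        (kernel_tens (local_id F) (kernel_ev F)))
     (local_runit (X := X)) _ _)
  (local_lunit (X := X))) => [[[]]//|[?[]]//|[i j]|//|].
  by rewrite (ord1 j).
move=> [o k] i [[[] []] z] [] + _ /=.
rewrite /= !summand1 stensr1 /= addr0 mulr1 mem_seq1 => /eqP[->].
rewrite (bigD1 (i, (i, i))) //= [X in _ + X]big1 => [|[b [c d]] ne]; last first.
  rewrite big1 // => r _ /=.
  case: (b =P i) => [eb|_]; last by rewrite mul0r if_same mulr0.
  case: (c =P d) => [ec|_]; last by rewrite !(mulr0, if_same).
  rewrite sum_overE big1 ?mul0r // => q _.
  case: (b =P c) => [ebc|_]; last by rewrite mul0r if_same mul0r.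
  by rewrite -ec -ebc eb eqxx in ne.
rewrite !eqxx /= addr0 -sum_overE.
have [->|_] := eqVneq k i.
  by case: (summand X i) => /=; compute_trees; field: hsqrt;
    rewrite ?hy ?eps_neq0.
rewrite sum_overE big1 // => r _; rewrite sum_overE big1 ?mul0r // => q _.
by rewrite mulr0 if_same mul0r.
Qed.

Lemma ezigzag2 X :
  (id_ X \otm coev X) ;; eassoc_inv X X X ;; (ev X \otm id_ X) ;; lunit X
  = runit X.
Proof.
pose F := base X.
apply: (kernel_ext (F := tensF F (base [:: S1])) (G := F)
  (kernel_local_r (G := tensF (base [:: S1]) F) (v' := fun i => (ord0, i))
     (kernel_comp
        (kernel_local_r (G := tensF F (tensF F F)) (H := tensF (tensF F F) F)
           (v' := fun c => (c.1.1, (c.1.2, c.2)))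
           (kernel_tens (local_id F) (kernel_coev F)) (local_assoc_inv F F F) _ _)
        (kernel_tens (kernel_ev F) (local_id F)))
     (local_lunit (X := X)) _ _)
  (local_runit (X := X))) => [[?[]]//|[[]]//|[j i]|//|].
  by rewrite (ord1 j).
move=> [k o] i [[[] []] z] [] + _ /=.
rewrite /= !summand1 stensr1 /= addr0 mulr1 mem_seq1 => /eqP[->].
rewrite (bigD1 ((i, i), i)) //= [X in _ + X]big1 => [|[[c d] b] ne]; last first.
  rewrite big1 // => r _ /=.
  case: (b =P i) => [eb|_]; last by rewrite mulr0 if_same mulr0.
  case: (c =P d) => [ec|_]; last by rewrite mul0r !(mulr0, if_same).
  rewrite sum_overE big1 ?mul0r // => q _.
  case: (d =P b) => [ebc|_]; last by rewrite mulr0 if_same mul0r.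
  by rewrite ec ebc eb eqxx in ne.
rewrite !eqxx /= addr0 -sum_overE.
have [->|_] := eqVneq k i.
  by case: (summand X i) => /=; compute_trees; field: hsqrt;
    rewrite ?hy ?eps_neq0.
rewrite sum_overE big1 // => r _; rewrite sum_overE big1 ?mul0r // => q _.
by rewrite mul0r if_same mul0r.
Qed.

(** * Quantum traces *)

Lemma big_diag (I : finType) (F : I * I -> C) :
  (forall i j, i != j -> F (i, j) = 0) -> \sum_b F b = \sum_i F (i, i).
Proof.
move=> F0; transitivity (\sum_i \sum_j F (i, j)).
  by rewrite pair_big; apply: eq_bigr => -[].
apply: eq_bigr => i _; rewrite (bigD1 i) //= big1 ?addr0 // => j ne.
by rewrite F0 // eq_sym.
Qed.

Lemma kernel_coev_tens X (g : ehom C X X) :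
  has_kernel (base [:: S1]) (tensF (base X) (base X)) (coev X ;; (g \otm id_ X))
    (fun _ _ b s => if s.2 == S1
       then coev_coef (summand X b.2) * ehom_mx g b.2 b.1 else 0).
Proof.
move=> p q; rewrite (kernel_comp (kernel_coev (base X))
  (kernel_tens (kernel_base g) (local_id (base X)))) /=.
move: (label q) => [[i j] z] /=; rewrite big_diag /= => [|k l ne]; last first.
  by rewrite big1 // => s _; rewrite (negbTE ne) mul0r.
rewrite (bigD1 j) //= [X in _ + X]big1 => [|k ne]; last first.
  by rewrite big1 // => s _; rewrite (negbTE ne) mulr0 if_same mulr0.
rewrite !eqxx addr0 -sum_overE.
by case: (summand X j); case: z => /=; compute_trees.
Qed.

Definition qdim (a : sym) : C := if a is SA then eps else 1.

Hypothesis b0 : beta != 0.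

(** For an atom A, coevaluation, twist, braiding and evaluation contribute
    [y sqrt_eps * beta^-2 * beta^2 * sqrt_eps / y = eps]. *)
Lemma qtraceE X (f : ehom C X X) p q :
  ehom_mx (coev X ;; ((f ;; twist X) \otm id_ X) ;; braid X X ;; ev X) p q
  = \sum_i ehom_mx f i i * qdim (summand X i).
Proof.
pose F := base X.
have Kf := kernel_local_r (v' := id) (kernel_base f) (local_twist beta F)
  (fun=> erefl) (fun=> erefl).
have K := kernel_local_r (G := tensF F F) (H := tensF F F)
  (v' := fun c => (c.2, c.1)) (kernel_coev_tens (f ;; twist X))
  (local_braid beta F F).
rewrite (kernel_comp (K _ _) (kernel_ev F)) /=; try by case.
rewrite big_diag /= => [|i j ne]; last first.
  by rewrite big1 // => s _; rewrite (negbTE ne) mulr0.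
apply: eq_bigr => i _; rewrite Kf eqxx -sum_overE /=.
by case: (summand X i) => /=; compute_trees; field: hsqrt; rewrite ?b0 ?hy.
Qed.

Lemma kernel_trace X (F : frame X) (f : ehom C X X) K (d : sym -> C) :
  has_kernel F F f K ->
  \sum_i ehom_mx f i i * d (summand X i)
  = \sum_a \sum_(t <- paths a) K a t a t * d (col a t).
Proof.
move=> fK; rewrite -frame_sum; apply: eq_bigr => i _.
by rewrite fK (frame_col F).
Qed.

Definition Smat (a b : sym) : C :=
  match a, b with S1, S1 => 1 | SA, SA => -1 | _, _ => eps end.

(** The entry at (A, A) is [beta^4 + beta^2 eps], one term for each of the
    summands 1 and A, and it reduces to [-1] by the equation of [beta]. *)
Lemma qtrace_double_braid a b p q : beta ^+ 2 = (1 - eps) * beta - 1 ->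
  let X := etens [:: a] [:: b] in
  let cc := braid [:: a] [:: b] ;; braid [:: b] [:: a] in
  ehom_mx (coev X ;; ((cc ;; twist X) \otm id_ X) ;; braid X X ;; ev X) p q
  = Smat a b.
Proof.
move=> hbeta; pose F := base [:: a]; pose G := base [:: b]; cbv zeta.
rewrite qtraceE.
rewrite (kernel_trace _
  (is_local_comp (local_braid beta F G) (local_braid beta G F))).
rewrite (big_pred1 (ord0, ord0)) => [|[i j]]; last first.
  by rewrite /= (ord1 i) (ord1 j).
rewrite -sum_overE /= !summand1.
by case: a {F}; case: b {G} => /=; compute_trees; ring: heps hbeta.
Qed.

Lemma Smat_sqr a c :
  \sum_b Smat a b * Smat b c = if a == c then 1 + eps ^+ 2 else 0.
Proof.
rewrite (reindex sym_of_bool) ?big_bool /=; last by exists bool_of_sym => -[].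
by case: a; case: c => /=; compute_trees; ring.
Qed.

(** * Simple objects and domination *)

Local Notation ground := (groundE eps sqrt_eps x y beta).

Lemma groundE_entry (k : C) p q : ehom_mx (ground k) p q = k.
Proof. by rewrite mxE !summand1. Qed.

Lemma ground_surj (f : ehom C [:: S1] [:: S1]) : f = ground (ehom_mx f ord0 ord0).
Proof. by apply: ehom_ext => p q; rewrite groundE_entry (ord1 p) (ord1 q). Qed.

(** Both sides of the equation that defines simplicity are 1 x 1 matrices, with
    the entry of [k] and the entry of [f]. *)
Lemma esimple a (f : ehom C [:: a] [:: a]) :
  exists! k : ehom C [:: S1] [:: S1],
    (k \otm id_ [:: a]) ;; lunit [:: a] = lunit [:: a] ;; f.
Proof.
have K (k : ehom C [:: S1] [:: S1]) :=
  kernel_local_r (G := tensF (base [:: S1]) (base [:: a]))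
    (v' := fun j => (ord0, j))
    (kernel_tens (kernel_base k) (local_id (base [:: a])))
    (local_lunit (X := [:: a])).
have L := kernel_local_l (local_lunit (X := [:: a])) (kernel_base f).
have vK : cancel (fun p : 'I_1 * 'I_1 => p.2) (fun j => (ord0, j)).
  by move=> [i j]; rewrite (ord1 i).
have entries (k : ehom C [:: S1] [:: S1]) p q :
    ehom_mx ((k \otm id_ [:: a]) ;; lunit [:: a]) p q = ehom_mx k ord0 ord0
    /\ ehom_mx (lunit [:: a] ;; f) p q = ehom_mx f ord0 ord0.
  rewrite (K k) // L /=.
  have := label_mem p; move: (label p) => [[i j] z] /=.
  rewrite (ord1 i) (ord1 j) (ord1 q) !summand1.
  move: (ehom_mx f ord0 ord0) => c; clear.
  by case: a => /=; case: z => //= _; rewrite !(addr0, mulr1, mul1r).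
have iffE (k : ehom C [:: S1] [:: S1]) :
    (k \otm id_ [:: a]) ;; lunit [:: a] = lunit [:: a] ;; f <->
    ehom_mx k ord0 ord0 = ehom_mx f ord0 ord0.
  split=> h; first by have [<- <-] := entries k ord0 ord0; rewrite h.
  by apply: ehom_ext => p q; have [-> ->] := entries k p q.
exists (ground (ehom_mx f ord0 ord0)); split.
  by apply/iffE; rewrite groundE_entry.
by move=> k /iffE h; rewrite [RHS]ground_surj h.
Qed.

(** The identity is the sum, over the summands, of projection followed by
    inclusion. *)
Lemma edominated X : exists (n : nat) (i : 'I_n -> sym)
    (f : forall r, ehom C X [:: i r]) (g : forall r, ehom C [:: i r] X),
  id_ X = \sum_(r < n) (f r ;; g r).
Proof.
exists (size X), (summand X), (fun r => mkhom (fun i _ => (i == r)%:R)),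
  (fun r => mkhom (fun _ i => (r == i)%:R)).
apply: ehom_ext => p q.
have -> (F : 'I_(size X) -> ehom C X X) :
    ehom_mx (\sum_(r < size X) F r) p q = \sum_r ehom_mx (F r) p q.
  elim/big_rec2: _ => [|r _ f _ <-]; last by rewrite ehomD.
  by rewrite -[LHS]/((0 : 'M_(_, _)) p q) mxE.
rewrite eid_mx mxE (bigD1 p) //= big1 ?addr0 => [|r ne]; last first.
  rewrite mxE big1 // => k _.
  by rewrite !mxE [p == r]eq_sym (negbTE ne) if_same mul0r.
rewrite mxE (big_ord_recl 0) big_ord0 !mxE !summand1 !eqxx addr0 mul1r.
by case: (p =P q) => [->|_]; rewrite ?eqxx ?if_same.
Qed.

(** * Modularity over a field *)

Hypotheses (hx : x != 0) (hbeta : beta ^+ 2 = (1 - eps) * beta - 1).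

Local Notation E := (catE eps sqrt_eps x y beta).

Lemma catE_category : is_category E.
Proof. by split=> *; [apply: ecompA | apply: ecomp1f | apply: ecompf1]. Qed.

Lemma catE_bilinear : is_Ab_bilinear E.
Proof.
split=> *; [exact: ecompDl | exact: ecompDr | exact: etensmDl | exact: etensmDr].
Qed.

Lemma catE_monoidal : is_monoidal E.
Proof.
split.
- exact: etensm_id.
- move=> *; exact: etensm_comp.
- move=> X Y Z; exists (eassoc_inv X Y Z).
  by split; [apply: eassocK | apply: eassoc_invK].
- move=> *; exact: eassoc_nat.
- by move=> X; exists (eid_cast C (esym (etens1s X))); apply: eid_castK.
- move=> *; exact: elunit_nat.
- by move=> X; exists (eid_cast C (esym (etenss1 X))); apply: eid_castK.
- move=> *; exact: erunit_nat.
- by move=> *; apply: epentagon.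
- move=> *; exact: etriangle.
Qed.

Lemma assoc_inverse (X Y Z : E) (a : mor (tens X (tens Y Z)) (tens (tens X Y) Z)) :
  inverse_mors (assoc X Y Z) a -> a = eassoc_inv X Y Z.
Proof.
case=> _ aK; rewrite -[LHS]ecompf1 -(eassocK hx X Y Z) -ecompA.
by rewrite [X in ecomp X _]aK ecomp1f.
Qed.

Lemma catE_braided : is_braided E.
Proof.
split.
- move=> X Y; exists (ebraid beta^-1 Y X); split; first exact: ebraidK.
  by have := @ebraidK beta^-1 Y X; rewrite invrK; apply; rewrite invr_eq0.
- move=> *; exact: ebraid_nat.
- by move=> *; apply: ehexagon1.
- by move=> X Y Z a /assoc_inverse->; apply: ehexagon2.
Qed.

Lemma catE_twisted : is_twisted E.
Proof.
split.
- move=> X; exists (etwist beta^-1 X); split; first exact: etwistK.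
  by have := @etwistK beta^-1 X; rewrite invrK; apply; rewrite invr_eq0.
- move=> *; exact: etwist_nat.
- by move=> *; apply: etwist_tens.
Qed.

Lemma catE_dual : is_dual_compatible E.
Proof.
split.
- exact: ezigzag1.
- by move=> X a /assoc_inverse->; apply: ezigzag2.
- move=> *; exact: ecoev_twist.
Qed.

Lemma catE_ground : is_ground_ring ground.
Proof.
split.
- exists (fun f : ehom C [:: S1] [:: S1] => ehom_mx f ord0 ord0) => [k|f].
    by rewrite groundE_entry.
  by rewrite [RHS]ground_surj.
- by move=> k l; apply: ehom_ext => p q; rewrite ehomD !groundE_entry.
- apply: ehom_ext => p q.
  by rewrite groundE_entry eid_mx mxE (ord1 p) (ord1 q).
- move=> k l; apply: ehom_ext => p q.
  by rewrite groundE_entry mxE big_ord1 !groundE_entry.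
Qed.

Lemma Smat_unitmx : 1 + eps ^+ 2 != 0 ->
  \matrix_(p < #|{: sym}|, q < #|{: sym}|) Smat (enum_val p) (enum_val q)
    \in unitmx.
Proof.
move=> hdet; set S := (X in X \in unitmx).
have SS : S *m ((1 + eps ^+ 2)^-1 *: S) = 1%:M.
  apply/matrixP => p q; rewrite -scalemxAr !mxE.
  under eq_bigr => r _ do rewrite !mxE.
  rewrite -(big_enum_val (fun b => Smat (enum_val p) b * Smat b (enum_val q))) /=.
  have -> : \sum_(b in {: sym}) Smat (enum_val p) b * Smat b (enum_val q)
      = \sum_b Smat (enum_val p) b * Smat b (enum_val q) by apply: eq_bigl.
  rewrite Smat_sqr (inj_eq enum_val_inj).
  by case: eqP => _; rewrite ?mulr0 // mulVf.
by have [] := mulmx1_unit SS.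
Qed.

Lemma catE_modular : 1 + eps ^+ 2 != 0 ->
  is_modular ground (simpleE eps sqrt_eps x y beta).
Proof.
move=> hdet; split.
- split; [exact: catE_category | exact: catE_monoidal | exact: catE_braided
         | exact: catE_twisted | exact: catE_dual].
- exact: catE_bilinear.
- exact: catE_ground.
- by move=> a f; apply: esimple.
- by exists S1.
- by move=> a; exists a, (id_ [:: a]), (id_ [:: a]); split; apply: ecomp1f.
- exact: edominated.
- exists Smat => [a b|]; last exact: Smat_unitmx.
  by apply: ehom_ext => p q; rewrite groundE_entry qtrace_double_braid.
Qed.

End Constants.
End Kernels.

(** * The values of beta *)

Section Trigonometry.
Variable R : realType.

(** In terms of [c = cos t] the hypothesis reads
    [(c + 1) (4 c^2 - 2 c - 1) = 0], and [c + 1] is nonzero with [sin t].  The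
    hypothesis holds for [t = pi/5] and [t = 3pi/5] since then [5 t] is an odd
    multiple of [pi]. *)
Lemma cos_golden (t : R) : cos (3 * t) = - cos (2 * t) -> sin t != 0 ->
  (2 * cos t) ^+ 2 = 2 * cos t + 1.
Proof.
have -> : 3 * t = t + t + t by ring.
have -> : 2 * t = t + t by ring.
rewrite !(cosD, sinD) => h s0.
have s2 : sin t * sin t = 1 - cos t * cos t by rewrite -!expr2 sin2cos2.
have c1 : cos t + 1 != 0.
  apply/eqP => c1; have : sin t * sin t = 0.
    have e : cos t = -1 by lra.
    by rewrite s2 e; ring.
  by move/eqP; rewrite mulf_eq0 orbb (negbTE s0).
apply: (mulfI c1); move: h; rewrite s2.
have -> : (sin t * cos t + cos t * sin t) * sin t
    = 2 * cos t * (1 - cos t * cos t) by rewrite -s2; ring.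
by move=> h; lra.
Qed.

Lemma pi5_golden : let t := 2 * cos (pi / 5) : R in t ^+ 2 = t + 1 /\ 0 < t.
Proof.
have pi0 := pi_gt0 R.
split; last by rewrite mulr_gt0 ?cos_gt0_pihalf //; lra.
apply: cos_golden; last by rewrite gt_eqF // sin_gt0_pi //; lra.
have -> : 3 * (pi / 5) = - (2 * (pi / 5)) + pi :> R by lra.
by rewrite cosDpi cosN.
Qed.

Lemma pi35_golden :
  let t := 2 * cos (3 * pi / 5) : R in t ^+ 2 = t + 1 /\ t < 0.
Proof.
have pi0 := pi_gt0 R; split.
  apply: cos_golden; last by rewrite gt_eqF // sin_gt0_pi //; lra.
  have -> : 3 * (3 * pi / 5) = - (2 * (3 * pi / 5)) + pi + pi + pi :> R by lra.
  by rewrite !cosDpi cosN opprK.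
have -> : 3 * pi / 5 = - (2 * pi / 5) + pi :> R by lra.
have : 0 < cos (2 * pi / 5) :> R by rewrite cos_gt0_pihalf //; lra.
by rewrite cosDpi cosN; lra.
Qed.

(** The two roots have product [-1]. *)
Lemma golden_unique (t u : R) :
  t ^+ 2 = t + 1 -> u ^+ 2 = u + 1 -> 0 < t * u -> t = u.
Proof.
move=> ht hu tu; apply/eqP; rewrite -subr_eq0.
have /eqP : (t - u) * (t + u - 1) = 0.
  have -> : (t - u) * (t + u - 1) = (t ^+ 2 - t) - (u ^+ 2 - u) by ring.
  by rewrite ht hu; ring.
rewrite mulf_eq0 => /orP[//|/eqP h].
have e : u = 1 - t by lra.
by move: tu; rewrite e mulrBr mulr1 -expr2 ht; lra.
Qed.

(** A nonzero imaginary part would force the real part to be [1/2] and the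
    square of the imaginary part to be [-5/4]. *)
Lemma golden_real (eps : R[i]) : eps ^+ 2 = eps + 1 ->
  exists2 a : R, eps = Complex a 0 & a ^+ 2 = a + 1.
Proof.
case: eps => a b /eqP; rewrite eq_complex /= => /andP[/eqP re /eqP im].
have /eqP : (2 * a - 1) * b = 0 by lra.
rewrite mulf_eq0 => /orP[/eqP h|/eqP b0].
  have e : a = 1 / 2 by lra.
  have := sqr_ge0 b; rewrite expr2; rewrite e in re; lra.
by exists a; rewrite b0 // expr2 in re *; lra.
Qed.

Lemma unit_circle_quadratic (c s r : R) :
  c ^+ 2 + s ^+ 2 = 1 -> 2 * c = 1 - r ->
  (Complex c s) ^+ 2 = (1 - Complex r 0) * Complex c s - 1.
Proof.
move=> cs cr; apply/eqP; rewrite eq_complex /=; apply/andP; split; apply/eqP.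
  rewrite -cr; move: cs; rewrite !expr2 => cs; lra.
by rewrite -cr; ring.
Qed.

Lemma quadratic_beta (eps beta : R[i]) : eps ^+ 2 = eps + 1 ->
  (0 < eps -> beta = expi (3 * pi / 5) \/ beta = expi (- (3 * pi / 5))) ->
  (eps < 0 -> beta = expi (pi / 5) \/ beta = expi (- (pi / 5))) ->
  beta ^+ 2 = (1 - eps) * beta - 1.
Proof.
case/golden_real=> a -> ha; rewrite !ltcE /= !eqxx /=.
have hu : (1 - a) ^+ 2 = (1 - a) + 1 by rewrite sqrrB ha; ring.
have au : a * (1 - a) = -1 by rewrite mulrBr mulr1 -expr2 ha; ring.
have [a0|a0|a0] := ltrgt0P a.
- move=> /(_ isT) hb _; have [h h0] := pi35_golden.
  have u0 : 1 - a < 0 by rewrite -(pmulr_rlt0 _ a0) au; lra.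
  have e : 2 * cos (3 * pi / 5) = 1 - a.
    by apply: golden_unique h hu _; rewrite nmulr_rgt0.
  case: hb => ->; apply: unit_circle_quadratic;
    by rewrite ?cosN ?sinN ?sqrrN ?cos2Dsin2.
- move=> _ /(_ isT) hb; have [h h0] := pi5_golden.
  have u0 : 0 < 1 - a by lra.
  have e : 2 * cos (pi / 5) = 1 - a := golden_unique h hu (mulr_gt0 h0 u0).
  case: hb => ->; apply: unit_circle_quadratic;
    by rewrite ?cosN ?sinN ?sqrrN ?cos2Dsin2.
- by exfalso; move: au; rewrite a0 mul0r => h; lra.
Qed.

End Trigonometry.

Theorem theorem5 (R : realType) (eps sqrt_eps x y beta : R[i])
    (heps : eps ^+ 2 = eps + 1) (hsqrt : sqrt_eps ^+ 2 = eps)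
    (hx : x != 0) (hy : y != 0)
    (hbeta_pos : 0 < eps ->
       beta = expi (3 * pi / 5) \/ beta = expi (- (3 * pi / 5)))
    (hbeta_neg : eps < 0 ->
       beta = expi (pi / 5) \/ beta = expi (- (pi / 5))) :
  is_modular (groundE eps sqrt_eps x y beta) (simpleE eps sqrt_eps x y beta).
Proof.
have hbeta := quadratic_beta heps hbeta_pos hbeta_neg.
have b0 : beta != 0.
  apply/eqP => e; move: hbeta; rewrite e expr2 !mulr0 add0r => /eqP.
  by rewrite eq_sym oppr_eq0 oner_eq0.
apply: catE_modular => //; have [a -> _] := golden_real heps.
rewrite eq_complex /= negb_and; apply/orP; left.
by rewrite mul0r subr0 -expr2 gt_eqF // ltr_wpDr ?ltr01 ?sqr_ge0.
Qed.
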